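(* Let $U=\{1,\ldots,N\}$, let $\pi=(\pi_1,\ldots,\pi_N)^\top$ with $0<\pi_k<1$ for every $k\in U$ and $n=\sum_{k\in U}\pi_k$ a positive integer, and let $I_1,\ldots,I_N$ be the membership indicators of a sample selected by Chromy sampling with parameter $\pi$ in $U$. For distinct units $k,l\in U$ let $\pi_{kl}=\Pr(I_k=1,\,I_l=1)$. With the cross-border units $k_i$, the quantities $a_i,b_i$ and the microstrata $U_i$ as defined in the context, put $$c_m=\frac{a_mb_m}{(1-a_m)(1-b_m)}\ \ (1\le m\le n-1),\qquad c(i,j)=\prod_{m=i}^{j-1}c_m\ \ (i<j),\qquad c(i,i)=1.$$ Then, for distinct units $k$ and $l$: 1. if $k$ and $l$ are two non cross-border units that belong to the same microstratum $U_i$, then $\pi_{kl}=0$; 2. if $k$ and $l$ are two non cross-border units that belong to distinct microstrata $U_i$ and $U_j$, respectively, where $i<j$, then $$\pi_{kl}=\pi_k\pi_l\{1-c(i,j)\};$$ 3. if $k=k_{i-1}$ is a cross-border unit and $l$ is a non cross-border unit that belongs to the microstratum $U_j$, where $i\le j$, then $$\pi_{kl}=\pi_k\pi_l\left[1-b_{i-1}(1-\pi_k)\{\pi_k(1-b_{i-1})\}^{-1}c(i,j)\right];$$ 4. if $l=k_{j-1}$ is a cross-border unit and $k$ is a non cross-border unit that belongs to the microstratum $U_i$, where $i<j$, then $$\pi_{kl}=\pi_k\pi_l\left\{1-(1-\pi_l)(1-b_{j-1})(\pi_lb_{j-1})^{-1}c(i,j)\right\};$$ 5. if $k=k_{i-1}$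 and $l=k_{j-1}$ are cross-border units, where $i<j$, then $$\pi_{kl}=\pi_k\pi_l\left[1-b_{i-1}(1-b_{j-1})(1-\pi_k)(1-\pi_l)\{\pi_k\pi_lb_{j-1}(1-b_{i-1})\}^{-1}c(i,j)\right].$$
   Context: Notation: $V_0=0$ and $V_k=\sum_{l=1}^k\pi_l$ for $k=1,\ldots,N$ (so $V_N=n$); $V_k^I=\lfloor V_k\rfloor$ and $V_k^F=V_k-V_k^I$. Cross-border units: for $i=1,\ldots,n-1$, $k_i$ is the unique unit $k\in U$ such that $V_{k-1}\le i$ and $V_k>i$; set $a_i=i-V_{k_i-1}$ and $b_i=V_{k_i}-i$. All other units are called non cross-border units. With $k_0=0$ and $k_n=N+1$ (these are not units of $U$), the microstrata are $U_i=\{k\in U:\ k_{i-1}\le k\le k_i\}$, $i=1,\ldots,n$. Chromy sampling with parameter $\pi$ in $U$ generates $I=(I_1,\ldots,I_N)^\top\in\{0,1\}^N$ sequentially as follows. Step $k=1$: $I_1=1$ with probability $\pi_1$, and $I_1=0$ otherwise. Step $k=2,\ldots,N$: conditionally on $(I_1,\ldots,I_{k-1})$, the probability that $I_k=1$ depends only on $\sum_{l=1}^{k-1}I_l$ and is given by: (a) if $V_k^F>V_{k-1}^F$: $\Pr(I_k=1\mid \sum_{l=1}^{k-1}I_l=V_{k-1}^I)=\frac{V_k^F-V_{k-1}^F}{1-V_{k-1}^F}$ and $\Pr(I_k=1\mid \sum_{l=1}^{k-1}I_l=V_{k-1}^I+1)=0$; (b) if $V_{k-1}^F\ge V_k^F$: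 $\Pr(I_k=1\mid \sum_{l=1}^{k-1}I_l=V_{k-1}^I)=1$ and $\Pr(I_k=1\mid \sum_{l=1}^{k-1}I_l=V_{k-1}^I+1)=\frac{V_k^F}{V_{k-1}^F}$. *)

(* Defs.v *)
From HB Require Import structures.
From mathcomp Require Import all_boot all_order all_algebra.
From mathcomp Require Import all_classical all_reals all_analysis.

Set Implicit Arguments.
Unset Strict Implicit.
Unset Printing Implicit Defensive.

Import Order.TTheory GRing.Theory Num.Theory.

Local Open Scope classical_set_scope.
Local Open Scope ring_scope.

(* Numbering convention: the population U = {1, ..., N} is 'I_N, the ordinal
   [k : 'I_N] being the unit number [k.+1].  Hence for the unit [k : 'I_N],
   the cumulated sums just before it and up to it included (V_{k-1} and V_k in
   the 1-based numbering) are [V pi k] and [V pi k.+1]. *)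

Section Cumulated.
Context {R : realType} {N : nat}.
Implicit Type pi : 'I_N -> R.

Definition V pi (k : nat) : R := \sum_(l < N | (l < k)%N) pi l.

Definition VI pi (k : nat) : int := Num.floor (V pi k).

Definition VF pi (k : nat) : R := V pi k - (VI pi k)%:~R.

(* 1-based number k_i of the i-th cross-border unit, with the conventions
   k_0 = 0 and k_n = N + 1.  For 0 < i < n the [pick] succeeds, on a unique
   unit, as soon as all [pi k] are positive with sum n: see
   [border_unit_unique] below. *)
Definition border pi (n i : nat) : nat :=
  if i == 0%N then 0%N
  else if i == n then N.+1
  else if [pick k : 'I_N | V pi k <= i%:R < V pi k.+1] is Some k then k.+1
  else 0%N.

Definition a_ pi (n i : nat) : R := i%:R - V pi (border pi n i).-1.

Definition b_ pi (n i : nat) : R := V pi (border pi n i) - i%:R.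

Definition cross_border pi (n : nat) (k : 'I_N) : Prop :=
  exists2 i : nat, (0 < i < n)%N & k.+1 = border pi n i.

Definition microstratum pi (n i : nat) : {set 'I_N} :=
  [set k : 'I_N | (border pi n i.-1 <= k.+1 <= border pi n i)%N]%SET.

Definition c_ pi (n m : nat) : R :=
  a_ pi n m * b_ pi n m / ((1 - a_ pi n m) * (1 - b_ pi n m)).

Definition cprod pi (n i j : nat) : R := \prod_(i <= m < j) c_ pi n m.

Lemma V_mono pi : (forall k, 0 < pi k) -> {homo V pi : i j / (i <= j)%N >-> i <= j}.
Proof.
move=> pi0 i j ij; rewrite /V big_mkcond [leRHS]big_mkcond /=.
apply: ler_sum => l _; case: ifP => li; first by rewrite (leq_trans li ij).
by case: ifP => // _; exact: ltW.
Qed.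

Lemma border_unit_unique pi (n i : nat) :
  (forall k, 0 < pi k) -> \sum_k pi k = n%:R -> (0 < i < n)%N ->
  exists! k : 'I_N, V pi k <= i%:R < V pi k.+1.
Proof.
move=> pi0 sumpi /andP[i0 iltn].
have V0 : V pi 0 = 0 by rewrite /V big_pred0.
have VN : V pi N = n%:R.
  by rewrite -sumpi /V; apply: eq_bigl => l; rewrite ltn_ord.
have exk : exists k, i%:R < V pi k by exists N; rewrite VN ltr_nat.
case: (ex_minnP exk) => [[|k]]; first by rewrite V0 ltNge ler0n.
move=> ik kmin.
have kN : (k < N)%N by apply: kmin; rewrite VN ltr_nat.
exists (Ordinal kN); split => /=.
  by rewrite ik andbT leNgt; apply/negP => /kmin; rewrite ltnn.
move=> l /andP[Vl lV]; apply/val_inj => /=; apply/eqP.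
rewrite eqn_leq (kmin _ lV : k <= l)%N /= leqNgt; apply/negP => kl.
by have := lt_le_trans ik (le_trans (V_mono pi0 kl) Vl); rewrite ltxx.
Qed.

End Cumulated.

Section Sampling.
Context d (T : measurableType d) (R : realType) (P : probability T R).

Definition prob (A : set T) : R := fine (P A).

(* Only meaningful when [prob B] is nonzero. *)
Definition cond_prob (A B : set T) : R := prob (A `&` B) / prob B.

Context {N : nat}.
Implicit Type I : 'I_N -> {RV P >-> bool}.

Definition selected I (k : 'I_N) : set T := [set w | I k w].

Definition history I (k : nat) (x : 'I_N -> bool) : set T :=
  [set w | forall l : 'I_N, (l < k)%N -> I l w = x l].

(* Conditioning is on the whole outcome [x] of the previous draws, whenever it
   has positive probability; the conditional probability depends on [x] only
   through the number [s] of units already selected.  Nothing is specified for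
   other values of [s]: they have probability 0. *)
Definition chromy_sampling (pi : 'I_N -> R) I : Prop :=
  forall k : 'I_N,
    (nat_of_ord k = 0%N -> prob (selected I k) = pi k) /\
    ((0 < k)%N -> forall x : 'I_N -> bool, 0 < prob (history I k x) ->
      let s : int := Posz (\sum_(l < N | (l < k)%N) x l)%N in
      let p := cond_prob (selected I k) (history I k x) in
      (VF pi k < VF pi k.+1 ->
        (s = VI pi k -> p = (VF pi k.+1 - VF pi k) / (1 - VF pi k)) /\
        (s = VI pi k + 1 -> p = 0)) /\
      (VF pi k.+1 <= VF pi k ->
        (s = VI pi k -> p = 1) /\
        (s = VI pi k + 1 -> p = VF pi k.+1 / VF pi k))).

Definition joint_incl I (k l : 'I_N) : R := prob (selected I k `&` selected I l).

End Sampling.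

(* Main.v *)
Require Import Defs.
From HB Require Import structures.
From mathcomp Require Import all_boot all_order all_algebra.
From mathcomp Require Import all_classical all_reals all_analysis.
From mathcomp Require Import ring lra.

Set Implicit Arguments.
Unset Strict Implicit.
Unset Printing Implicit Defensive.

Import Order.TTheory GRing.Theory Num.Theory.

Local Open Scope classical_set_scope.
Local Open Scope ring_scope.

(* Let S_m be the number of units drawn among the first m. Given the past, S_m
   takes only two values, so the mean of I_m is an affine function of S_(m-1)
   and, for k < m,
     E[I_k (S_m - V_m)] = (1 + s_m) E[I_k (S_(m-1) - V_(m-1))],
     pi_km = pi_k pi_m + s_m E[I_k (S_(m-1) - V_(m-1))],
   where s_m is the slope.  Inside the i-th stratum 1 + s_m is
   (i - V_m) / (i - V_(m-1)), so the left-hand side of the first recursion stays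
   proportional to i - V_m; crossing the border i multiplies the constant of
   proportionality by c_i. *)

(** * Cumulated sums and the slope of the conditional mean of a draw *)

Section CumulatedSums.
Context {R : realType} {N : nat} (pi : 'I_N -> R).
Context (pi01 : forall k, 0 < pi k < 1).

Lemma V0 : V pi 0 = 0.
Proof. by rewrite /V big_pred0. Qed.

Lemma VN : V pi N = \sum_k pi k.
Proof. by rewrite /V; apply: eq_bigl => l; rewrite ltn_ord. Qed.

Lemma prefix_sumS (W : nmodType) (x : 'I_N -> W) (k : 'I_N) :
  \sum_(l < N | (l < k.+1)%N) x l = \sum_(l < N | (l < k)%N) x l + x k.
Proof.
rewrite (bigD1 k) ?ltnS //= addrC; congr (_ + _); apply: eq_bigl => l.
by rewrite ltnS (ltn_neqAle l k) andbC.
Qed.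

Lemma VS (k : 'I_N) : V pi k.+1 = V pi k + pi k.
Proof. exact: prefix_sumS. Qed.

Lemma V_le i j : (i <= j)%N -> V pi i <= V pi j.
Proof. by apply: V_mono => k; case/andP: (pi01 k). Qed.

Lemma V_lt_ltn i j : V pi i < V pi j -> (i < j)%N.
Proof. by rewrite ltnNge; apply: contraTN => /V_le; rewrite leNgt. Qed.

Lemma VF_ge0 k : 0 <= VF pi k.
Proof. by rewrite subr_ge0 floor_le. Qed.

Lemma VF_lt1 k : VF pi k < 1.
Proof. by rewrite ltrBlDl -intrD1 floorD1_gt. Qed.

Lemma VI_eq k (i : int) : i%:~R <= V pi k < i%:~R + 1 -> VI pi k = i.
Proof. by move=> h; apply: floor_def; rewrite intrD1. Qed.

(** As [0 < pi k < 1], the integer part moves by at most one. The indices let a single case analysis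
    settle [VI], [VF] and the test between rules (a) and (b); [0 < VF pi k] keeps the divisor of
    rule (b) nonzero. *)
Variant step_spec (k : 'I_N) : int -> R -> bool -> Prop :=
| StepWithin of VF pi k + pi k < 1 :
    step_spec k (VI pi k) (VF pi k + pi k) true
| StepAcross of 1 <= VF pi k + pi k & 0 < VF pi k :
    step_spec k (VI pi k + 1) (VF pi k + pi k - 1) false.

Lemma stepP (k : 'I_N) :
  step_spec k (VI pi k.+1) (VF pi k.+1) (VF pi k < VF pi k.+1).
Proof.
have /andP[p0 p1] := pi01 k.
have f0 := VF_ge0 k; have f1 := VF_lt1 k.
have vk : V pi k = VF pi k + (VI pi k)%:~R by rewrite subrK.
have [h|h] := ltP (VF pi k + pi k) 1.
  have e : VI pi k.+1 = VI pi k.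
    by apply: VI_eq; rewrite VS vk; apply/andP; split; lra.
  have -> : VF pi k.+1 = VF pi k + pi k by rewrite /VF e VS; ring.
  by rewrite e; have -> : VF pi k < VF pi k + pi k by [lra]; constructor.
have e : VI pi k.+1 = VI pi k + 1.
  by apply: VI_eq; rewrite VS vk intrD1; apply/andP; split; lra.
have -> : VF pi k.+1 = VF pi k + pi k - 1 by rewrite /VF e VS intrD1; ring.
rewrite e; have -> : VF pi k < VF pi k + pi k - 1 = false.
  by apply/negbTE; rewrite -leNgt; lra.
by constructor => //; lra.
Qed.

(* Given the past, the mean of the [k]-th draw is an affine function of the
   number of units already drawn, with this slope. *)
Definition slope (k : 'I_N) : R :=
  if VF pi k < VF pi k.+1 then - pi k / (1 - VF pi k)
  else - (1 - pi k) / VF pi k.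

Definition excess (k : nat) (x : 'I_N -> bool) : R :=
  (\sum_(l < N | (l < k)%N) x l)%N%:R - V pi k.

Lemma excess0 x : excess 0 x = 0.
Proof. by rewrite /excess V0 big_pred0 ?subr0. Qed.

Lemma excessS (k : 'I_N) x : excess k.+1 x = excess k x + ((x k)%:R - pi k).
Proof. by rewrite /excess VS prefix_sumS natrD; ring. Qed.

Lemma VF_eq k (i : nat) : i%:R - 1 <= V pi k < i%:R -> VF pi k = V pi k - (i%:R - 1).
Proof.
move=> /andP[iV Vi]; rewrite /VF (@VI_eq k (i%:Z - 1)) intrB -pmulrn //.
by rewrite subrK iV.
Qed.

Lemma slope_within (k : 'I_N) (i : nat) :
  i%:R - 1 <= V pi k -> V pi k.+1 <= i%:R ->
  slope k = - pi k / (i%:R - V pi k).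
Proof.
move=> iV; rewrite VS => Vi; have /andP[p0 p1] := pi01 k.
have ef : VF pi k = V pi k - (i%:R - 1) by apply: VF_eq; apply/andP; split; lra.
rewrite /slope; case: stepP => h; first by congr (_ / _); rewrite ef; ring.
(* The unit ends exactly at [i]: rule (b) applies, and both formulas equal -1. *)
move=> f0; have e1 : V pi k = i%:R - pi k by lra.
by rewrite ef e1; field; lra.
Qed.

Lemma slope_across (k : 'I_N) (i : nat) :
  V pi k < i%:R -> i%:R <= V pi k.+1 ->
  slope k = - (1 - pi k) / (1 - (i%:R - V pi k)).
Proof.
move=> Vi; rewrite VS => iV; have /andP[p0 p1] := pi01 k.
have ef : VF pi k = V pi k - (i%:R - 1) by apply: VF_eq; apply/andP; split; lra.
rewrite /slope; case: stepP => h; first by move: h; rewrite ef; lra.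
by move=> f0; congr (_ / _); rewrite ef; ring.
Qed.

End CumulatedSums.

(** * The joint law of the indicators as a finite distribution *)

Section FiniteLaw.
Context d (T : measurableType d) (R : realType) (P : probability T R).
Context {N : nat} (I : 'I_N -> {RV P >-> bool}).
Implicit Types (x y z : 'I_N -> bool) (f g h : ('I_N -> bool) -> R).

(** The [{ffun}] encoding has finitely many values, so every expectation below is a finite sum. *)
Definition outcome (w : T) : {ffun 'I_N -> bool} := [ffun l => I l w].

Definition pmf (y : {ffun 'I_N -> bool}) : R := prob P (outcome @^-1` [set y]).

Definition mean f : R := \sum_(y : {ffun 'I_N -> bool}) pmf y * f y.

Lemma measurable_outcome (y : {ffun 'I_N -> bool}) :
  measurable (outcome @^-1` [set y]).
Proof.
have -> : outcome @^-1` [set y] = \bigcap_(l in [set: 'I_N]) (I l @^-1` [set y l]).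
  apply/seteqP; split => [w /= <- l _ /=|w h]; first by rewrite ffunE.
  by apply/ffunP => l; rewrite ffunE; apply: h.
apply: fin_bigcap_measurable; first exact: finite_finset.
by move=> l _; rewrite -[X in measurable X]setTI; apply: measurable_funP.
Qed.

Lemma pmf_ge0 (y : {ffun 'I_N -> bool}) : 0 <= pmf y.
Proof. by rewrite fine_ge0. Qed.

Lemma prob_ge0 (A : set T) : 0 <= prob P A.
Proof. by rewrite fine_ge0. Qed.

(** Bridge from the measure to finite sums: the event is a finite disjoint union of measurable
    fibres of [outcome]. *)
Lemma prob_outcome (A : pred {ffun 'I_N -> bool}) :
  prob P [set w | A (outcome w)] = \sum_(y | A y) pmf y.
Proof.
have -> : [set w | A (outcome w)] = \bigcup_(y in [set` A]) outcome @^-1` [set y].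
  by apply/seteqP; split => [w Aw|w [y Ay /= ->]] //; exists (outcome w).
rewrite /pmf /prob sum_fine; last first.
  by move=> y _; apply: fin_num_measure; exact: measurable_outcome.
rewrite measure_fin_bigcup.
- congr fine; rewrite (@bigfs _ _ _ _ (index_enum _)) ?index_enum_uniq // => y _.
  by rewrite mem_index_enum.
- exact: finite_finset.
- by move=> y z _ _ [w [/= <- <-]].
- by move=> y _; exact: measurable_outcome.
Qed.

Lemma prob_history k x :
  prob P (history I k x) =
  \sum_(y : {ffun 'I_N -> bool} | [forall l : 'I_N, (l < k)%N ==> (y l == x l)]) pmf y.
Proof.
rewrite -prob_outcome; congr (prob P _); apply/seteqP; split => w /= h.
  by apply/forallP => l; apply/implyP => lk; rewrite ffunE h.
by move=> l lk; have /forallP/(_ l) := h; rewrite lk ffunE => /eqP.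
Qed.

Lemma prob_selected_history (k : 'I_N) x :
  prob P (selected I k `&` history I k x) =
  \sum_(y : {ffun 'I_N -> bool} |
    [forall l : 'I_N, (l < k)%N ==> (y l == x l)]) pmf y * (y k)%:R.
Proof.
rewrite [RHS](eq_bigr (fun y : {ffun _ -> _} => if y k then pmf y else 0)); last first.
  by move=> y _; case: (y k); rewrite ?mulr1 ?mulr0.
rewrite -big_mkcondr -prob_outcome.
congr (prob P _); apply/seteqP; split => w /=.
  move=> [Iw h]; apply/andP; split; last by rewrite ffunE.
  by apply/forallP => l; apply/implyP => lk; rewrite ffunE h.
move=> /andP[/forallP h]; rewrite ffunE => Iw; split => // l lk.
by have := h l; rewrite lk ffunE => /eqP.
Qed.

Lemma prob_historyS (k : 'I_N) x :
  prob P (history I k.+1 x) =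
  if x k then prob P (selected I k `&` history I k x)
  else prob P (history I k x) - prob P (selected I k `&` history I k x).
Proof.
rewrite prob_selected_history !prob_history -sumrB.
have e (y : {ffun 'I_N -> bool}) : [forall l : 'I_N, (l < k.+1)%N ==> (y l == x l)] =
    [forall l : 'I_N, (l < k)%N ==> (y l == x l)] && (y k == x k).
  apply/forallP/andP => [h|[/forallP h hk] l].
    split; last by have := h k; rewrite ltnSn.
    by apply/forallP => l; apply/implyP => lk; have := h l; rewrite ltnS ltnW.
  rewrite ltnS leq_eqVlt; apply/implyP => /orP[/eqP/val_inj -> //|lk].
  by have := h l; rewrite lk.
rewrite (eq_bigl _ _ e) big_mkcondr /=.
by case: (x k); apply: eq_bigr => y _; case: (y k); rewrite ?mulr1 ?mulr0 ?subrr ?subr0.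
Qed.

(** Discrete form of measurability with respect to the first [k] draws. *)
Definition adapted (k : nat) f : Prop :=
  forall x y, (forall l : 'I_N, (l < k)%N -> x l = y l) -> f x = f y.

Lemma adapted_cst k (c : R) : adapted k (fun=> c).
Proof. by []. Qed.

Lemma eq_mean f g :
  (forall y : {ffun 'I_N -> bool}, 0 < pmf y -> f y = g y) -> mean f = mean g.
Proof.
move=> fg; apply: eq_bigr => y _.
have [<-|p0] := eqVneq 0 (pmf y); first by rewrite !mul0r.
by rewrite fg // lt_def eq_sym p0 pmf_ge0.
Qed.

Lemma meanD f g : mean (fun y => f y + g y) = mean f + mean g.
Proof. by rewrite -big_split; apply: eq_bigr => y _; rewrite mulrDr. Qed.

Lemma meanZ (c : R) f : mean (fun y => c * f y) = c * mean f.
Proof. by rewrite mulr_sumr; apply: eq_bigr => y _; rewrite mulrCA. Qed.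

Lemma mean1 : mean (fun=> 1) = 1.
Proof.
rewrite /mean; under eq_bigr do rewrite mulr1.
rewrite -prob_outcome (_ : [set w | _] = setT) ?/prob ?probability_setT //.
by apply/seteqP; split.
Qed.

(* Averaging over the classes of outcomes that share the first [k] draws. *)
Lemma mean_cond (k : 'I_N) f h : adapted k f -> adapted k h ->
  (forall x, 0 < prob P (history I k x) ->
    cond_prob P (selected I k) (history I k x) = h x) ->
  mean (fun y => f y * (y k)%:R) = mean (fun y => f y * h y).
Proof.
move=> af ah condh.
(* [past] erases the draws from [k] on, which gives each class a canonical representative. *)
pose past (y : {ffun 'I_N -> bool}) := [ffun l : 'I_N => (l < k)%N && y l].
rewrite /mean (partition_big past xpredT) //= [RHS](partition_big past xpredT) //=.
apply: eq_bigr => z _.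
have [zz|zz] := eqVneq (past z) z; last first.
  (* [past] is idempotent, so a [z] that it moves indexes an empty class. *)
  suff e (y : {ffun 'I_N -> bool}) : (past y == z) = false
    by rewrite !(big_pred0 _ _ _ _ e).
  apply/negbTE; apply: contra zz => /eqP <-.
  by apply/eqP/ffunP => l; rewrite !ffunE; case: (l < k)%N.
have e (y : {ffun 'I_N -> bool}) : (past y == z) =
    [forall l : 'I_N, (l < k)%N ==> (y l == z l)].
  apply/eqP/forallP => [<- l|yz]; first by rewrite ffunE; case: (l < k)%N => /=.
  rewrite -zz; apply/ffunP => l; rewrite !ffunE; have := yz l.
  by case: (l < k)%N => //= /eqP.
rewrite !(eq_bigl _ _ e).
have toz g (y : {ffun 'I_N -> bool}) :
    adapted k g -> [forall l : 'I_N, (l < k)%N ==> (y l == z l)] -> g y = g z.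
  by move=> ag /forallP yz; apply: ag => l lk; have := yz l; rewrite lk => /eqP.
transitivity (f z * prob P (selected I k `&` history I k z)).
  rewrite prob_selected_history mulr_sumr.
  by apply: eq_bigr => y yz; rewrite (toz f) // mulrCA.
transitivity (f z * h z * prob P (history I k z)); last first.
  rewrite prob_history mulr_sumr.
  by apply: eq_bigr => y yz; rewrite (toz f) // (toz h) // mulrC.
rewrite -mulrA; congr (_ * _).
(* On a null history [condh] says nothing, but then both sides vanish. *)
have [p0|p0] := eqVneq (prob P (history I k z)) 0; last first.
  by rewrite -condh ?divfK // lt_def p0 prob_ge0.
rewrite p0 mulr0; apply/eqP; rewrite eq_le prob_ge0 andbT -p0.
rewrite prob_selected_history prob_history; apply: ler_sum => y _.
by rewrite ler_piMr ?pmf_ge0 // lern1 leq_b1.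
Qed.

Lemma joint_incl_mean (k l : 'I_N) :
  joint_incl I k l = mean (fun y => (y k)%:R * (y l)%:R).
Proof.
rewrite /mean (eq_bigr (fun y : {ffun _ -> _} => if y k && y l then pmf y else 0)).
  rewrite -big_mkcond -prob_outcome; congr (prob P _).
  by apply/seteqP; split => w /=; rewrite !ffunE => /andP.
by move=> y _; case: (y k) (y l) => -[]; rewrite ?(mulr0, mul0r, mulr1).
Qed.

Lemma pmf_history_gt0 k (y : {ffun 'I_N -> bool}) :
  0 < pmf y -> 0 < prob P (history I k y).
Proof.
move=> /lt_le_trans; apply; rewrite prob_history (bigD1 y) /=.
  by rewrite lerDl sumr_ge0 // => z _; apply: pmf_ge0.
by apply/forallP => l; rewrite eqxx implybT.
Qed.

End FiniteLaw.

(** * Affine conditional law of a draw and moments of the excess *)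

Section ChromySampling.
Context d (T : measurableType d) (R : realType) (P : probability T R).
Context {N : nat} (pi : 'I_N -> R) (I : 'I_N -> {RV P >-> bool}).
Context (pi01 : forall k, 0 < pi k < 1) (chromyI : chromy_sampling pi I).

Definition drawn (k : nat) (x : 'I_N -> bool) : int :=
  Posz (\sum_(l < N | (l < k)%N) x l)%N.

Lemma excess_low k x : drawn k x = VI pi k -> excess pi k x = - VF pi k.
Proof. by move=> e; rewrite /excess /VF -e -pmulrn opprB. Qed.

Lemma excess_high k x : drawn k x = VI pi k + 1 -> excess pi k x = 1 - VF pi k.
Proof.
move=> e; rewrite /excess /VF -[X in X - _]/((drawn k x)%:~R) e intrD1; ring.
Qed.

Lemma history0 x : history I 0 x = setT.
Proof. by apply/seteqP; split. Qed.

(** On the two admissible counts the excess is [- VF pi k] or [1 - VF pi k], and the affine function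
    takes there the two prescribed probabilities. The first draw fits too, its excess being 0. *)
Lemma cond_draw (k : 'I_N) x : 0 < prob P (history I k x) ->
  drawn k x = VI pi k \/ drawn k x = VI pi k + 1 ->
  cond_prob P (selected I k) (history I k x) = pi k + slope pi k * excess pi k x.
Proof.
move=> hx hd; have [first_step later_step] := chromyI k.
have [k0|k0] := posnP k.
  rewrite /cond_prob k0 history0 setIT first_step // /prob probability_setT /=.
  by rewrite excess0 mulr0 addr0 divr1.
have [within across] := later_step k0 x hx; move: within across => /=.
rewrite -/(drawn k x) /slope leNgt.
have /andP[p0 p1] := pi01 k; have f0 := VF_ge0 pi k; have f1 := VF_lt1 pi k.
case: (stepP pi01 k) => [_|f2 f3] within across.
  have [low high] := within isT.
  case: hd => hd; first by rewrite (low hd) (excess_low hd); field; lra.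
  by rewrite (high hd) (excess_high hd); field; lra.
have [low high] := across isT.
case: hd => hd; first by rewrite (low hd) (excess_low hd); field; lra.
by rewrite (high hd) (excess_high hd); field; lra.
Qed.

(** Induction on [k]: the count could leave the two values only by drawing when rule (a) gives
    probability 0, or by not drawing when rule (b) gives probability 1; either would make the
    history null. *)
Lemma drawn_range k x : (k <= N)%N -> 0 < prob P (history I k x) ->
  drawn k x = VI pi k \/ drawn k x = VI pi k + 1.
Proof.
elim: k => [_ _|k IHk kN].
  by left; rewrite /drawn /VI V0 floor0 big_pred0.
pose k' := Ordinal kN.
have drawnS : drawn k.+1 x = drawn k' x + x k'.
  by rewrite /drawn (prefix_sumS _ k') PoszD.
rewrite (prob_historyS _ k') => hS.
have hx : 0 < prob P (history I k x).
  move: hS; rewrite lt_def => /andP[/eqP hS _].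
  rewrite lt_def prob_ge0 andbT; apply/eqP => h0; apply: hS.
  have s0 : prob P (selected I k' `&` history I k' x) = 0.
    apply/eqP; rewrite eq_le prob_ge0 andbT -h0.
    rewrite prob_selected_history prob_history; apply: ler_sum => y _.
    by rewrite ler_piMr ?pmf_ge0 // lern1 leq_b1.
  by rewrite s0 h0 subrr if_same.
have {IHk} hd : drawn k' x = VI pi k' \/ drawn k' x = VI pi k' + 1 := IHk (ltnW kN) hx.
have := cond_draw (k := k') hx hd.
set p := cond_prob _ _ _ => ep.
(* A history of positive probability gives positive conditional probability to its own last draw. *)
have {}hS : if x k' then 0 < p else p < 1.
  move: hS; rewrite /p /cond_prob; case: (x k') => hS; first by rewrite divr_gt0.
  by rewrite ltr_pdivrMr // mul1r -subr_gt0.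
have /andP[p0 p1] := pi01 k'; have f0 := VF_ge0 pi k'; have f1 := VF_lt1 pi k'.
rewrite drawnS; move: ep hS; rewrite /slope; case: (stepP pi01 k') => [_|_ f2] ep hS.
  case: hd => hd; rewrite hd; first by case: (x k'); rewrite ?addr0; [right|left].
  have p_0 : p = 0 by rewrite ep (excess_high hd); field; rewrite subr_eq0 gt_eqF.
  by move: hS; rewrite p_0 ltxx; case: (x k') => // _; right; rewrite addr0.
case: hd => hd; rewrite hd.
  have p_1 : p = 1 by rewrite ep (excess_low hd); field; rewrite gt_eqF.
  by move: hS; rewrite p_1 ltxx; case: (x k') => // _; left.
by case: (x k'); rewrite ?addr0; [right|left].
Qed.

Lemma adapted_excess k : adapted k (@excess R N pi k).
Proof.
by move=> x y xy; rewrite /excess; congr (_%:R - _); apply: eq_bigr => l lk; rewrite xy.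
Qed.

Lemma adapted_draw (k : 'I_N) m : (k < m)%N -> adapted (R := R) m (fun x => (x k)%:R).
Proof. by move=> km x y xy; rewrite xy. Qed.

(** Conditioning on the past replaces the [k]-th draw by its affine conditional mean; all later
    moments come from this identity. *)
Lemma mean_draw (k : 'I_N) f : adapted k f ->
  mean I (fun y => f y * (y k)%:R) =
  pi k * mean I f + slope pi k * mean I (fun y => f y * excess pi k y).
Proof.
move=> af; rewrite -!meanZ -meanD.
rewrite (mean_cond (h := fun x => pi k + slope pi k * excess pi k x)) //.
- by congr (mean I _); apply/funext => y; ring.
- by move=> x y xy; rewrite (adapted_excess xy).
- by move=> x hx; apply: cond_draw => //; apply: drawn_range => //; apply: ltnW.
Qed.

Lemma mean_excessS (k : 'I_N) f : adapted k f ->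
  mean I (fun y => f y * excess pi k.+1 y) =
  (1 + slope pi k) * mean I (fun y => f y * excess pi k y).
Proof.
move=> af.
transitivity (mean I (fun y => f y * excess pi k y + (f y * (y k)%:R + - pi k * f y))).
  by congr (mean I _); apply/funext => y; rewrite excessS; ring.
by rewrite !meanD meanZ mean_draw //; ring.
Qed.

Lemma mean_excess k : (k <= N)%N -> mean I (excess pi k) = 0.
Proof.
elim: k => [_|k IHk kN].
  rewrite (_ : excess pi 0 = fun y => 0 * 1); first by rewrite meanZ mul0r.
  by apply/funext => y; rewrite excess0 mul0r.
have := mean_excessS (k := Ordinal kN) (@adapted_cst _ _ _ 1).
have e m : (fun y => 1 * excess pi m y) = excess pi m by apply/funext => y; rewrite mul1r.
by rewrite !e /= IHk ?mulr0 // ltnW.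
Qed.

Lemma mean_indicator (k : 'I_N) : mean I (fun y => (y k)%:R) = pi k.
Proof.
have := mean_draw (@adapted_cst _ _ k 1).
have -> : (fun y : 'I_N -> bool => 1 * (y k)%:R) = fun y => (y k)%:R :> R.
  by apply/funext => y; rewrite mul1r.
have -> : (fun y => 1 * excess pi k y) = excess pi k by apply/funext => y; rewrite mul1r.
by rewrite mean_excess ?mean1 1?ltnW // => ->; ring.
Qed.

(** The two possible values [- f] and [1 - f] are the roots of X^2 = (1 - 2f) X + f (1 - f), so the
    square is affine in the excess, whose mean is 0. *)
Lemma mean_excess_sqr k : (k <= N)%N ->
  mean I (fun y => excess pi k y * excess pi k y) = VF pi k * (1 - VF pi k).
Proof.
move=> kN; pose f := VF pi k.
transitivity (mean I (fun y => (1 - 2 * f) * excess pi k y + f * (1 - f) * 1)).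
  apply: eq_mean => y /(pmf_history_gt0 k) /(drawn_range kN)[h|h].
    by rewrite (excess_low h) -/f; ring.
  by rewrite (excess_high h) -/f; ring.
by rewrite meanD !meanZ mean_excess // mean1 -/f; ring.
Qed.

(** For [m <= N] the excess is centred, so this is the covariance of the [k]-th indicator with the
    number of units drawn among the first [m]. *)
Definition draw_excess (k : 'I_N) (m : nat) : R :=
  mean I (fun y => (y k)%:R * excess pi m y).

Lemma draw_excessS (k l : 'I_N) : (k < l)%N ->
  draw_excess k l.+1 = (1 + slope pi l) * draw_excess k l.
Proof. by move=> kl; apply: mean_excessS; apply: adapted_draw. Qed.

Lemma joint_incl_lt (k l : 'I_N) : (k < l)%N ->
  joint_incl I k l = pi k * pi l + slope pi l * draw_excess k l.
Proof.
move=> kl; rewrite joint_incl_mean mean_draw; last exact: adapted_draw.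
by rewrite mean_indicator (mulrC (pi l)).
Qed.

Lemma draw_excess_self (k : 'I_N) :
  draw_excess k k.+1 = pi k * (1 - pi k) + slope pi k * (VF pi k * (1 - VF pi k)).
Proof.
(* An indicator equals its square, so multiplying [excessS] by it leaves the factor [1 - pi k]. *)
transitivity (mean I (fun y => excess pi k y * (y k)%:R + (1 - pi k) * (y k)%:R)).
  congr (mean I _); apply/funext => y; rewrite excessS.
  by case: (y k) => /=; ring.
have kN := ltnW (ltn_ord k).
rewrite meanD meanZ mean_indicator (mean_draw (@adapted_excess k)).
by rewrite mean_excess // mean_excess_sqr //; ring.
Qed.

Lemma draw_excess_within (k : 'I_N) (i : nat) :
  i%:R - 1 <= V pi k -> V pi k.+1 <= i%:R ->
  draw_excess k k.+1 = pi k * (i%:R - V pi k.+1).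
Proof.
move=> iV Vi; have /andP[p0 p1] := pi01 k.
rewrite draw_excess_self (slope_within pi01 iV Vi).
move: Vi; rewrite VS => Vi; have -> : VF pi k = V pi k - (i%:R - 1).
  by apply: VF_eq; apply/andP; split; lra.
by field; lra.
Qed.

Lemma draw_excess_across (k : 'I_N) (i : nat) :
  V pi k <= i%:R -> i%:R <= V pi k.+1 ->
  draw_excess k k.+1 = (1 - pi k) * (V pi k.+1 - i%:R).
Proof.
move=> Vi iV; have /andP[p0 p1] := pi01 k.
have [Vi_lt|iV_le] := ltP (V pi k) i%:R; last first.
  (* A unit starting exactly at [i] stays within the next stratum, and the two starting values
     agree. *)
  have e : V pi k = i%:R by apply/le_anti; rewrite Vi.
  rewrite (draw_excess_within (i := i.+1)) ?VS -?natr1 ?e; last lra; last lra.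
  by ring.
rewrite draw_excess_self (slope_across pi01 Vi_lt iV).
move: iV; rewrite VS => iV; have -> : VF pi k = V pi k - (i%:R - 1).
  by apply: VF_eq; apply/andP; split; lra.
by field; lra.
Qed.

End ChromySampling.

(** * Position of units relative to borders, and propagation of the covariance *)

Section JointInclusion.
Context d (T : measurableType d) (R : realType) (P : probability T R).
Context {N : nat} (n : nat) (pi : 'I_N -> R) (I : 'I_N -> {RV P >-> bool}).
Context (pi01 : forall k, 0 < pi k < 1) (sum_pi : \sum_(k < N) pi k = n%:R).
Context (chromyI : chromy_sampling pi I).

Lemma V_le_total k : (k <= N)%N -> V pi k <= n%:R.
Proof. by move=> kN; rewrite -sum_pi -VN V_le. Qed.

Lemma border_pick i : (0 < i < n)%N ->
  exists2 k : 'I_N, border pi n i = k.+1 & V pi k <= i%:R < V pi k.+1.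
Proof.
move=> i0n; have /andP[i0 iltn] := i0n.
have [k [kP _]] := border_unit_unique (fun k => proj1 (andP (pi01 k))) sum_pi i0n.
rewrite /border gtn_eqF // ltn_eqF //.
by case: pickP => [k' kP'|/(_ k)]; [exists k' | rewrite kP].
Qed.

Lemma border_across (k : 'I_N) i : (0 < i < n)%N -> k.+1 = border pi n i ->
  V pi k <= i%:R < V pi k.+1.
Proof. by move=> /border_pick[k' -> ?] [/val_inj ->]. Qed.

(** No cumulated sum exceeds [n], which forces [i < n]; uniqueness of the straddling unit then
    identifies the border. *)
Lemma across_border (k : 'I_N) (i : nat) : (0 < i)%N -> V pi k <= i%:R < V pi k.+1 ->
  (i < n)%N /\ border pi n i = k.+1.
Proof.
move=> i0 kP; have /andP[_ iV] := kP.
have iltn : (i < n)%N by rewrite -(ltr_nat R) (lt_le_trans iV) // V_le_total.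
have i0n : (0 < i < n)%N by rewrite i0.
have [k' -> kP'] := border_pick i0n.
have [k'' [_ uniq_k]] :=
  border_unit_unique (fun k => proj1 (andP (pi01 k))) sum_pi i0n.
by rewrite -(uniq_k _ kP) -(uniq_k _ kP').
Qed.

(** The unit differs from both bounding cross-border units, hence lies strictly between them. The
    lower bound is strict only for [1 < i]: the first stratum starts at [V pi 0 = 0]. *)
Lemma microstratum_within (k : 'I_N) i : (0 < i <= n)%N ->
  ~ cross_border pi n k -> k \in microstratum pi n i ->
  [/\ i%:R - 1 <= V pi k, (1 < i)%N -> i%:R - 1 < V pi k & V pi k.+1 <= i%:R].
Proof.
case: i => // i; rewrite -natr1 addrK ltnS /= => ilen nck; rewrite inE /= => /andP[ik ki].
have lower : (0 < i)%N -> i%:R < V pi k.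
  move=> i0; have i0n : (0 < i < n)%N by rewrite i0.
  have [k' ek' /andP[_ iV]] := border_pick i0n.
  apply: (lt_le_trans iV); apply: V_le => //.
  rewrite ltn_neqAle; move: ik; rewrite ek' ltnS => ->; rewrite andbT.
  by apply/eqP => ekk; apply: nck; exists i; rewrite // ek' ekk.
split => //.
  have [i0|/lower/ltW //] := posnP i.
  by have := V_le pi01 (leq0n k); rewrite i0 V0.
rewrite natr1; have [e|iltn] := eqVneq i.+1 n; first by rewrite e V_le_total.
have i0n : (0 < i.+1 < n)%N by rewrite /= (ltn_neqAle i.+1) iltn.
have [k' ek' /andP[Vi _]] := border_pick i0n.
apply: le_trans Vi; apply: V_le => //.
rewrite ltn_neqAle; move: ki; rewrite ek' ltnS => ->; rewrite andbT.
by apply/eqP => ekk; apply: nck; exists i.+1; rewrite // ek' ekk.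
Qed.

Lemma cprodS i j : (i <= j)%N -> cprod pi n i j.+1 = cprod pi n i j * c_ pi n j.
Proof. by move=> ij; rewrite /cprod big_nat_recr. Qed.

(** Induction on [m]. Strata are open on the left and closed on the right, so that each [V pi m]
    determines its index [i]; [K] depends only on how unit [k] starts. *)
Lemma draw_excess_chain (k : 'I_N) (K : R) (i0 : nat) : (0 < i0)%N ->
  i0%:R - 1 < V pi k.+1 <= i0%:R ->
  draw_excess pi I k k.+1 = K * (i0%:R - V pi k.+1) ->
  forall m i, (k < m <= N)%N -> i%:R - 1 < V pi m <= i%:R ->
  draw_excess pi I k m = K * (i%:R - V pi m) * cprod pi n i0 i.
Proof.
move=> i0_gt0 /andP[lo0 hi0] start; elim=> // m IHm i /andP[km mN] /andP[lo hi].
have [ekm|kltm] : nat_of_ord k = m \/ (k < m)%N.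
  by move: km; rewrite ltnS leq_eqVlt => /orP[/eqP|]; [left|right].
  suff -> : i = i0 by rewrite -ekm start /cprod big_geq // mulr1.
  move: lo hi; rewrite -ekm => lo hi; apply/eqP.
  rewrite eqn_leq -(ltnS i) -(ltnS i0) -!(ltr_nat R) -!natr1.
  by apply/andP; split; lra.
pose m' := Ordinal mN; have /andP[p0 p1] := pi01 m'.
have Vm : V pi m.+1 = V pi m + pi m' := VS pi m'.
have kV : V pi k.+1 <= V pi m by exact: V_le.
have -> : draw_excess pi I k m.+1 = (1 + slope pi m') * draw_excess pi I k m.
  exact: (draw_excessS pi01 chromyI (l := m')).
(* Either unit [m'] stays in stratum [i], and [1 + slope] just updates the distance to [i], or it
   crosses [i - 1]. *)
have [within|across] := ltP (i%:R - 1) (V pi m).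
  rewrite (IHm i) ?kltm ?(ltnW mN) //; last by rewrite within; lra.
  rewrite (@slope_within _ _ _ pi01 m' i) ?(ltW within) //=.
  by rewrite Vm; field; lra.
case: i lo hi across => [|i].
  by rewrite sub0r; have := V_le pi01 (leq0n m); rewrite V0; lra.
rewrite -!natr1 addrK => lo hi Vi.
have i0i : (i0 <= i)%N by rewrite -ltnS -(ltr_nat R) -natr1; lra.
have i_gt0 : (0 < i)%N by exact: leq_trans i0i.
have [iltn eb] := across_border (k := m') i_gt0 (introT andP (conj Vi lo)).
rewrite (IHm i) ?kltm ?(ltnW mN) //; last by apply/andP; split; lra.
(* With a, b for the two parts of the crossing unit, [1 + slope] is b / (1 - a); it turns the old
   distance a into (1 - b) times [c_ pi n i], and 1 - b is the new distance. *)
rewrite cprodS // /c_ /a_ /b_ eb /= Vm.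
(* A unit starting exactly at [i] has [a_ pi n i = 0], and both sides vanish. *)
have [Vi_lt|iV] := ltP (V pi m) i%:R; last first.
  by have -> : V pi m = i%:R; [lra | ring].
rewrite (@slope_across _ _ _ pi01 m' i) //; last exact: ltW.
by field; apply/andP; split; lra.
Qed.

(** The slope at [l] has the distance [j - V pi l] as denominator, which cancels the one supplied by
    the chain. *)
Lemma joint_incl_within (k l : 'I_N) (K : R) (i j : nat) : (0 < i)%N ->
  i%:R - 1 < V pi k.+1 <= i%:R ->
  draw_excess pi I k k.+1 = K * (i%:R - V pi k.+1) ->
  (k < l)%N -> j%:R - 1 < V pi l -> V pi l.+1 <= j%:R ->
  joint_incl I k l = pi k * pi l - K * pi l * cprod pi n i j.
Proof.
move=> i0 Vk start kl jV Vj; rewrite (joint_incl_lt pi01 chromyI kl).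
rewrite (slope_within pi01 (ltW jV) Vj).
have /andP[p0 p1] := pi01 l; move: Vj; rewrite VS => Vj.
rewrite (draw_excess_chain i0 Vk start (i := j)); first by field; lra.
  by rewrite kl ltnW.
by apply/andP; split; lra.
Qed.

(** The chain stops in stratum [j], before [l]. The leftover factor a / (1 - a) equals [c_ pi n j]
    times (1 - b) / b, whence the product up to [j.+1]. *)
Lemma joint_incl_across (k l : 'I_N) (K : R) (i j : nat) : (0 < i <= j)%N ->
  i%:R - 1 < V pi k.+1 <= i%:R ->
  draw_excess pi I k k.+1 = K * (i%:R - V pi k.+1) ->
  (k < l)%N -> (j < n)%N -> l.+1 = border pi n j ->
  joint_incl I k l = pi k * pi l
    - K * (1 - pi l) * (1 - b_ pi n j) / b_ pi n j * cprod pi n i j.+1.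
Proof.
move=> /andP[i0 ij] Vk start kl jn bj; rewrite (joint_incl_lt pi01 chromyI kl).
have jn' : (0 < j < n)%N by rewrite (leq_trans i0 ij).
have /andP[Vj jV] := border_across jn' bj.
have /andP[p0 p1] := pi01 l; have Vl := VS pi l.
rewrite (draw_excess_chain i0 Vk start (i := j)); last 2 first.
- by rewrite kl ltnW.
- by apply/andP; split; lra.
rewrite cprodS // /c_ /a_ /b_ -bj /= Vl.
have [Vj_lt|jV_le] := ltP (V pi l) j%:R; last first.
  by have -> : V pi l = j%:R; [lra | ring].
rewrite (slope_across pi01 Vj_lt (ltW jV)).
by field; apply/and3P; split; lra.
Qed.

Lemma start_within (k : 'I_N) i : (0 < i <= n)%N ->
  ~ cross_border pi n k -> k \in microstratum pi n i ->
  i%:R - 1 < V pi k.+1 <= i%:R /\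
  draw_excess pi I k k.+1 = pi k * (i%:R - V pi k.+1).
Proof.
move=> i0n nck ki; have [lo _ hi] := microstratum_within i0n nck ki.
have /andP[p0 _] := pi01 k; split; last exact: draw_excess_within.
by rewrite hi andbT VS; lra.
Qed.

(** Unit [k] ends in stratum [i.+1], at distance [1 - b_ pi n i] from its end; dividing the starting
    covariance by this distance gives the constant. *)
Lemma start_across (k : 'I_N) i : (0 < i < n)%N -> k.+1 = border pi n i ->
  [/\ 0 < b_ pi n i < 1, i.+1%:R - 1 < V pi k.+1 <= i.+1%:R &
  draw_excess pi I k k.+1 =
  b_ pi n i * (1 - pi k) / (1 - b_ pi n i) * (i.+1%:R - V pi k.+1)].
Proof.
move=> i0n bi; have /andP[Vi iV] := border_across i0n bi.
have /andP[p0 p1] := pi01 k; have Vk := VS pi k.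
rewrite (draw_excess_across pi01 chromyI Vi (ltW iV)) /b_ -bi -natr1.
split.
- by apply/andP; split; lra.
- by apply/andP; split; lra.
- by clear bi; field; lra.
Qed.

End JointInclusion.

(** * The five cases, from the starting constants and the chain *)

Theorem theorem3 (d : measure_display) (T : measurableType d) (R : realType)
    (P : probability T R) (N n : nat) (pi : 'I_N -> R)
    (I : 'I_N -> {RV P >-> bool})
    (pi01 : forall k : 'I_N, 0 < pi k < 1)
    (n_gt0 : (0 < n)%N)
    (sum_pi : \sum_(k < N) pi k = n%:R)
    (chromyI : chromy_sampling pi I)
    (k l : 'I_N) (neq_kl : k != l) :
  [/\ (* 1 *)
      forall i : nat, (1 <= i <= n)%N ->
        ~ cross_border pi n k -> ~ cross_border pi n l ->
        k \in microstratum pi n i -> l \in microstratum pi n i ->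
        joint_incl I k l = 0,
      (* 2 *)
      forall i j : nat, (1 <= i)%N -> (i < j)%N -> (j <= n)%N ->
        ~ cross_border pi n k -> ~ cross_border pi n l ->
        k \in microstratum pi n i -> l \in microstratum pi n j ->
        joint_incl I k l = pi k * pi l * (1 - cprod pi n i j),
      (* 3 *)
      forall i j : nat, (2 <= i)%N -> (i <= j)%N -> (j <= n)%N ->
        k.+1 = border pi n i.-1 ->
        ~ cross_border pi n l -> l \in microstratum pi n j ->
        joint_incl I k l =
          pi k * pi l *
          (1 - b_ pi n i.-1 * (1 - pi k) * (pi k * (1 - b_ pi n i.-1))^-1
               * cprod pi n i j),
      (* 4 *)
      forall i j : nat, (1 <= i)%N -> (i < j)%N -> (j <= n)%N ->
        l.+1 = border pi n j.-1 ->
        ~ cross_border pi n k -> k \in microstratum pi n i ->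
        joint_incl I k l =
          pi k * pi l *
          (1 - (1 - pi l) * (1 - b_ pi n j.-1) * (pi l * b_ pi n j.-1)^-1
               * cprod pi n i j)
    & (* 5 *)
      forall i j : nat, (2 <= i)%N -> (i < j)%N -> (j <= n)%N ->
        k.+1 = border pi n i.-1 -> l.+1 = border pi n j.-1 ->
        joint_incl I k l =
          pi k * pi l *
          (1 - b_ pi n i.-1 * (1 - b_ pi n j.-1) * (1 - pi k) * (1 - pi l)
               * (pi k * pi l * b_ pi n j.-1 * (1 - b_ pi n i.-1))^-1
               * cprod pi n i j)].
Proof.
have /andP[pk0 pk1] := pi01 k; have /andP[pl0 pl1] := pi01 l.
split.
(* Only this case is symmetric in [k] and [l]; in the others the order follows from the strata, by
   monotonicity of [V]. *)
- move=> i i1n; wlog kl : k l neq_kl {pk0 pk1 pl0 pl1} / (k < l)%N.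
    move=> same nck ncl ki li; have [kl|lk|/val_inj ekl] := ltngtP k l.
    + exact: same.
    + by rewrite /joint_incl setIC; apply: same; rewrite // eq_sym.
    + by rewrite ekl eqxx in neq_kl.
  move=> nck ncl ki li.
  have [Vk start] := start_within pi01 sum_pi chromyI i1n nck ki.
  have [_ _ Vl] := microstratum_within pi01 sum_pi i1n ncl li.
  have /andP[i0 _] := i1n; have /andP[lo _] := Vk.
  rewrite (joint_incl_within pi01 sum_pi chromyI i0 Vk start kl _ Vl).
    (* Same stratum: the product is empty and the constant is [pi k], so the terms cancel. *)
    by rewrite /cprod big_geq // mulr1 subrr.
  by rewrite (lt_le_trans lo) // V_le.
- move=> i j i1 ij jn nck ncl ki lj.
  have i1n : (0 < i <= n)%N by rewrite i1 ltnW // (leq_trans ij).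
  have j1n : (0 < j <= n)%N by rewrite (leq_trans i1) // ltnW.
  have [Vk start] := start_within pi01 sum_pi chromyI i1n nck ki.
  have [_ /(_ (leq_ltn_trans i1 ij)) jV Vj] := microstratum_within pi01 sum_pi j1n ncl lj.
  have kl : (k < l)%N.
    rewrite -ltnS; apply: (V_lt_ltn pi01); have /andP[_ hi] := Vk.
    apply: (le_lt_trans hi); rewrite VS.
    by move: ij; rewrite -(ler_nat R) -natr1; lra.
  by rewrite (joint_incl_within pi01 sum_pi chromyI i1 Vk start kl jV Vj); ring.
(* The index is shifted: the border is now [i], and the chain starts in stratum [i.+1]. *)
- move=> [|i] // j i1 ij jn /= bi ncl lj.
  have i1n : (0 < i < n)%N by apply/andP; split; [exact: i1 | exact: leq_trans jn].
  have j1n : (0 < j <= n)%N by rewrite jn (leq_trans _ ij).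
  have [/andP[b0 b1] Vk start] := start_across pi01 sum_pi chromyI i1n bi.
  have [_ /(_ (leq_trans i1 ij)) jV Vj] := microstratum_within pi01 sum_pi j1n ncl lj.
  have kl : (k < l)%N.
    apply: (V_lt_ltn pi01); have /andP[hi _] := border_across pi01 sum_pi i1n bi.
    apply: (le_lt_trans hi); apply: le_lt_trans jV.
    by move: ij; rewrite -(ler_nat R) -natr1; lra.
  rewrite (joint_incl_within pi01 sum_pi chromyI (ltn0Sn i) Vk start kl jV Vj).
  by clear bi; field; apply/andP; split; lra.
- move=> i [|j] // i1 ij jn /= bj nck ki.
  have j1n : (0 < j < n)%N by rewrite (leq_trans i1 ij).
  have i1n : (0 < i <= n)%N by rewrite i1 /=; exact: ltnW (leq_trans ij jn).
  have [Vk start] := start_within pi01 sum_pi chromyI i1n nck ki.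
  have [/andP[b0 b1] _ _] := start_across pi01 sum_pi chromyI j1n bj.
  have kl : (k < l)%N.
    rewrite -ltnS; apply: (V_lt_ltn pi01); have /andP[_ hi] := Vk.
    have /andP[_ jV] := border_across pi01 sum_pi j1n bj.
    by apply: (le_lt_trans hi); apply: le_lt_trans jV; rewrite ler_nat.
  rewrite (joint_incl_across pi01 sum_pi chromyI _ Vk start kl jn bj) ?i1 //.
  by clear bj; field; apply/andP; split; lra.
- move=> [|i] // [|j] // i1 ij jn /= bi bj.
  have i1n : (0 < i < n)%N by apply/andP; split; [exact: i1 | exact: leq_trans (ltnW jn)].
  have j1n : (0 < j < n)%N by rewrite jn andbT; exact: leq_trans i1 (ltnW ij).
  have [/andP[b0 b1] Vk start] := start_across pi01 sum_pi chromyI i1n bi.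
  have [/andP[c0 c1] _ _] := start_across pi01 sum_pi chromyI j1n bj.
  have kl : (k < l)%N.
    rewrite -ltnS; apply: (V_lt_ltn pi01); have /andP[_ hi] := Vk.
    have /andP[_ jV] := border_across pi01 sum_pi j1n bj.
    by apply: (le_lt_trans hi); apply: le_lt_trans jV; rewrite ler_nat.
  rewrite (joint_incl_across pi01 sum_pi chromyI _ Vk start kl jn bj) //.
  by clear bi bj; field; apply/and4P; split; lra.
Qed.
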